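(* Let $X$ be a metric space whose similarity matrix $Z$ is invertible and whose magnitude $|X|$ is nonzero, and let $\mathbf{w}=Z^{-1}\mathbf{1}$ be its weighting. Then $$\begin{pmatrix}0 & \mathbf{1}^T\\ \mathbf{1}& Z\end{pmatrix}^{-1}=\begin{pmatrix}-|X|^{-1} & \mathbf{w}^T/|X|\\ \mathbf{w}/|X| & \tfrac12 K^\dagger\end{pmatrix}.$$
   Context: Metric spaces $(X,d)$ are finite and nonempty; $n=\#X$. The similarity matrix $Z\in\mathbb{R}^{X\times X}$ has entries $z_{ij}=e^{-d(i,j)}$. When $Z$ is invertible, the weighting is $\mathbf{w}=Z^{-1}\mathbf{1}$ and the magnitude is $|X|=\mathbf{1}^T\mathbf{w}$, where $\mathbf{1}$ is the all-ones vector. The centered similarity matrix is $K=\tfrac12\big(I-\tfrac{\mathbf{1}\mathbf{1}^T}{n}\big)Z\big(I-\tfrac{\mathbf{1}\mathbf{1}^T}{n}\big)$, and $K^\dagger$ is its Moore--Penrose pseudoinverse. *)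

(* Defs.v *)
From HB Require Import structures.
From mathcomp Require Import all_boot all_order all_algebra.
From mathcomp Require Import all_classical all_reals all_analysis.

Set Implicit Arguments.
Unset Strict Implicit.
Unset Printing Implicit Defensive.

Import Order.TTheory GRing.Theory Num.Theory.
Local Open Scope classical_set_scope.
Local Open Scope ring_scope.

#[short(type="finMetricType")]
HB.structure Definition FinMetric (R : numDomainType) :=
  { X of Finite X & Metric R X }.

Section MoorePenrose.
Variable R : realFieldType.

(* Since R is real, the conjugate transposes in the Penrose equations are
   plain transposes. *)
Definition is_moore_penrose m n (A : 'M[R]_(m, n)) (B : 'M[R]_(n, m)) : Prop :=
  [/\ A *m B *m A = A, B *m A *m B = B,
      (A *m B)^T = A *m B & (B *m A)^T = B *m A].

(* By [moore_penroseP] and [is_moore_penrose_uniq] below, the default value 0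
   of [xget] is never used and the choice is unique. *)
Definition moore_penrose m n (A : 'M[R]_(m, n)) : 'M[R]_(n, m) :=
  xget 0 [set B | is_moore_penrose A B].

Lemma is_moore_penrose_uniq m n (A : 'M[R]_(m, n)) (B C : 'M[R]_(n, m)) :
  is_moore_penrose A B -> is_moore_penrose A C -> B = C.
Proof.
move=> [B1 B2 B3 B4] [C1 C2 C3 C4].
have AB_AC : A *m B = A *m C.
  rewrite -B3 -{1}C1 -mulmxA trmx_mul B3 C3 mulmxA.
  by rewrite B1.
have BA_CA : B *m A = C *m A.
  rewrite -B4 -{1}C1 -!mulmxA mulmxA trmx_mul B4 C4.
  by rewrite -mulmxA (mulmxA A B) B1.
by rewrite -B2 BA_CA -mulmxA AB_AC mulmxA C2.
Qed.

Lemma gram_unitmx m n (A : 'M[R]_(m, n)) : row_free A -> A *m A^T \in unitmx.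
Proof.
move=> Afree; rewrite -row_free_unit -kermx_eq0; apply/eqP/row_matrixP => i.
rewrite row0; set u := row i _.
have uAA : u *m (A *m A^T) = 0.
  by rewrite /u -row_mul mulmx_ker row0.
suff uA : u *m A = 0 by apply: (row_free_inj Afree); rewrite mul0mx.
have /matrixP/(_ 0 0) : (u *m A) *m (u *m A)^T = 0.
  by rewrite trmx_mul mulmxA -(mulmxA u) uAA mul0mx.
rewrite !mxE => /eqP; rewrite psumr_eq0; last first.
  by move=> k _; rewrite !mxE -expr2 sqr_ge0.
move=> /allP s0; apply/rowP => k; rewrite [RHS]mxE.
have := s0 k (mem_index_enum _).
by rewrite [_^T _ _]mxE /= mulf_eq0 orbb => /eqP.
Qed.

Lemma moore_penroseP m n (A : 'M[R]_(m, n)) :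
  is_moore_penrose A (moore_penrose A).
Proof.
rewrite /moore_penrose.
suff [B AB] : exists B, is_moore_penrose A B by case: xgetP => // /(_ B).
have [r [C [D [CD Cu Du]]]] : exists r (C : 'M[R]_(m, r)) (D : 'M[R]_(r, n)),
    [/\ C *m D = A, C^T *m C \in unitmx & D *m D^T \in unitmx].
  exists (\rank A), (col_base A), (row_base A); split.
  - exact: mulmx_base.
  - have := @gram_unitmx _ _ (col_base A)^T; rewrite trmxK; apply.
    by rewrite /row_free mxrank_tr; apply: col_base_full.
  - exact/gram_unitmx/row_base_free.
pose D' := D^T *m invmx (D *m D^T); pose C' := invmx (C^T *m C) *m C^T.
have DD' : D *m D' = 1%:M by rewrite mulmxA mulmxV.
have C'C : C' *m C = 1%:M by rewrite -mulmxA mulVmx.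
have AB : A *m (D' *m C') = C *m C'.
  by rewrite -CD -mulmxA (mulmxA D) DD' mul1mx.
have BA : (D' *m C') *m A = D' *m D.
  by rewrite -CD -mulmxA (mulmxA C') C'C mul1mx.
exists (D' *m C'); split.
- by rewrite AB -CD -mulmxA (mulmxA C') C'C mul1mx.
- by rewrite BA -mulmxA (mulmxA D) DD' mul1mx.
- by rewrite AB !trmx_mul trmx_inv trmx_mul !trmxK !mulmxA.
- by rewrite BA !trmx_mul trmx_inv trmx_mul !trmxK !mulmxA.
Qed.

End MoorePenrose.

Section Magnitude.
Variables (R : realType) (X : finMetricType R).

(* Matrices over X are indexed by 'I_#|X| through the enumeration of X. *)
Definition similarity_mx : 'M[R]_#|X| :=
  \matrix_(i, j) expR (- mdist (enum_val i : X) (enum_val j : X)).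

Definition ones : 'cV[R]_#|X| := const_mx 1.

(* Meaningful only when [similarity_mx] is invertible, and likewise for
   [magnitude]: invmx is the identity on singular matrices. *)
Definition weighting : 'cV[R]_#|X| := invmx similarity_mx *m ones.

Definition magnitude : R := (ones^T *m weighting) 0 0.

Definition centering_mx : 'M[R]_#|X| :=
  1%:M - (#|X|%:R)^-1 *: (ones *m ones^T).

Definition centered_similarity_mx : 'M[R]_#|X| :=
  2^-1 *: (centering_mx *m similarity_mx *m centering_mx).

End Magnitude.

Arguments similarity_mx {R} X.
Arguments ones {R} X.
Arguments weighting {R} X.
Arguments magnitude {R} X.
Arguments centering_mx {R} X.
Arguments centered_similarity_mx {R} X.

(* Main.v *)
Require Import Defs.
From mathcomp Require Import all_boot all_order all_algebra.
From mathcomp Require Import all_classical all_reals all_analysis.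

(** Write [w = Z^-1 1] and [m = 1^T w], and let [S = Z^-1 - w w^T / m].  The
    theorem is two independent facts about [S].

    First, [S] is the lower right block of the inverse of the bordered matrix:
    block inversion through the invertible block [Z] has Schur complement
    [- m], and the rest of the inverse is the one in the statement
    ([mul_bordered_mx]).

    Second, [2 S] is the pseudoinverse of [K = P Z P / 2], where [P] is the
    orthogonal projection with kernel spanned by [1].  The rank one term
    makes [S] vanish on [1], so [P] acts as the identity on [S] ([projection_rank1K]),
    and [Z S = I - 1 w^T / m] differs from [I] only by a matrix that [P]
    kills.  Hence [(P Z P) S = P Z S = P].  As [Z] and [S] are symmetric,
    transposing gives [S (P Z P) = P] too, so both products are the symmetric
    projection [P], which fixes both factors: these are the Penrose equations
    ([moore_penrose_compression]), and uniqueness of the pseudoinverse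
    concludes. *)

Set Implicit Arguments.
Unset Strict Implicit.
Unset Printing Implicit Defensive.

Import Order.TTheory GRing.Theory Num.Theory.
Local Open Scope ring_scope.

(** For [u] the all-ones vector this is the magnitude. *)
Definition inv_form (F : fieldType) n (Z : 'M[F]_n) (u : 'cV[F]_n) : F :=
  (u^T *m (invmx Z *m u)) 0 0.

(** A rank one correction of [invmx Z], chosen to vanish on [u]. *)
Definition deflated_inv (F : fieldType) n (Z : 'M[F]_n) (u : 'cV[F]_n) :
    'M[F]_n :=
  let w := invmx Z *m u in invmx Z - (inv_form Z u)^-1 *: (w *m w^T).

Lemma trmx_sandwich (F : fieldType) n (P Z : 'M[F]_n) :
  P^T = P -> Z^T = Z -> (P *m Z *m P)^T = P *m Z *m P.
Proof. by move=> Psym Zsym; rewrite !trmx_mul Psym Zsym mulmxA. Qed.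

Lemma similarity_mx_sym (R : realType) (X : finMetricType R) :
  (similarity_mx X)^T = similarity_mx X.
Proof. by apply/matrixP => i j; rewrite !mxE metric_sym. Qed.

Section Bordered.
Variables (F : fieldType) (n : nat) (Z : 'M[F]_n) (u : 'cV[F]_n).
Hypotheses (Zsym : Z^T = Z) (Zunit : Z \in unitmx).
Hypothesis form_neq0 : inv_form Z u != 0.

Let w := invmx Z *m u.
Let m := inv_form Z u.
Let S := deflated_inv Z u.

Lemma trmx_deflated_inv : S^T = S.
Proof.
by rewrite /S /deflated_inv linearB linearZ /= trmx_mul trmxK trmx_inv Zsym.
Qed.

Lemma mulmx_deflated_inv : Z *m S = 1%:M - m^-1 *: (u *m w^T).
Proof. by rewrite mulmxBr -scalemxAr mulmxA /w mulKVmx ?mulmxV. Qed.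

Lemma border_deflated_inv : u^T *m S = 0.
Proof.
(* [u^T Z^-1] is [w^T] because [Z] is symmetric. *)
have uZ : u^T *m invmx Z = w^T by rewrite trmx_mul trmx_inv Zsym.
rewrite mulmxBr -scalemxAr mulmxA uZ -/w.
rewrite [u^T *m w]mx11_scalar.
by rewrite mul_scalar_mx scalerA mulVf // scale1r subrr.
Qed.

Lemma mul_bordered_mx :
  block_mx 0 u^T u Z *m block_mx (- m^-1)%:M (m^-1 *: w^T) (m^-1 *: w) S
  = 1%:M :> 'M[F]_(1 + n).
Proof.
rewrite mulmx_block !mul0mx !add0r -scalemxAr [u^T *m w]mx11_scalar.
rewrite -mul_scalar_mx -scalar_mxM mulVf //.
rewrite border_deflated_inv mulmx_deflated_inv mul_mx_scalar.
rewrite -!scalemxAr /w mulKVmx // scaleNr addNr addrCA subrr addr0.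
by rewrite -scalar_mx_block.
Qed.

Lemma invmx_bordered :
  let M : 'M[F]_(1 + n) := block_mx 0 u^T u Z in
  M \in unitmx /\
  invmx M = block_mx (- m^-1)%:M (m^-1 *: w^T) (m^-1 *: w) S.
Proof.
move=> M; have MN := mul_bordered_mx; have [Munit _] := mulmx1_unit MN.
split; first exact: Munit.
by rewrite -[RHS](mulKmx Munit) MN mulmx1.
Qed.

End Bordered.

(** The normalization of [c] makes [P] the orthogonal projection onto the
    complement of [u]. *)
Lemma projection_rank1K (F : fieldType) n (u : 'cV[F]_n) c
    (P := 1%:M - c *: (u *m u^T)) :
  c * (u^T *m u) 0 0 = 1 ->
  [/\ P^T = P, P *m u = 0
    & forall A : 'M[F]_n, u^T *m A = 0 -> P *m A = A].
Proof.
move=> cu; split.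
- by rewrite linearB linearZ /= trmx_mul trmxK trmx1.
- rewrite mulmxBl mul1mx -scalemxAl -mulmxA [u^T *m u]mx11_scalar.
  by rewrite mul_mx_scalar scalerA cu scale1r subrr.
- move=> A uA.
  by rewrite mulmxBl mul1mx -scalemxAl -mulmxA uA mulmx0 scaler0 subr0.
Qed.

(** When both products of [A] and [B] are one symmetric matrix [P], the Penrose
    equations only ask that [P] fix [A] and [B]. *)
Lemma moore_penrose_projection (R : realFieldType) n (A B P : 'M[R]_n) :
  P^T = P -> A *m B = P -> B *m A = P -> P *m A = A -> P *m B = B ->
  moore_penrose A = B.
Proof.
move=> Psym AB BA PA PB; apply: is_moore_penrose_uniq (moore_penroseP A) _.
by split; rewrite ?AB ?BA.
Qed.

(** Both [Z] compressed by [P] and [deflated_inv Z u] live on the complement of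
    [u], and there they are inverse to each other: [Z *m deflated_inv Z u] is
    the identity up to a matrix with columns along [u], which [P] kills. *)
Lemma moore_penrose_compression (R : realFieldType) n (Z : 'M[R]_n)
    (u : 'cV[R]_n) c a (P := 1%:M - c *: (u *m u^T)) :
  Z^T = Z -> Z \in unitmx -> inv_form Z u != 0 ->
  c * (u^T *m u) 0 0 = 1 -> a != 0 ->
  moore_penrose (a *: (P *m Z *m P)) = a^-1 *: deflated_inv Z u.
Proof.
move=> Zsym Zunit form_neq0 cu a0; set S := deflated_inv Z u.
have [Psym Pu Pfix] := projection_rank1K cu.
rewrite -/P in Psym Pu Pfix.
have PS : P *m S = S by exact/Pfix/border_deflated_inv.
have uP : u^T *m P = 0 by rewrite -Psym -trmx_mul Pu trmx0.
have PP : P *m P = P by exact: Pfix.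
have KS : P *m Z *m P *m S = P.
  rewrite -mulmxA PS -mulmxA mulmx_deflated_inv //.
  by rewrite mulmxBr mulmx1 -scalemxAr mulmxA Pu mul0mx scaler0 subr0.
have SK : S *m (P *m Z *m P) = P.
  rewrite -[RHS]Psym -[in RHS]KS trmx_mul trmx_sandwich //.
  by rewrite trmx_deflated_inv.
apply: (moore_penrose_projection Psym).
- by rewrite -scalemxAl -scalemxAr scalerA mulfV // scale1r.
- by rewrite -scalemxAl -scalemxAr scalerA mulVf // scale1r.
- by rewrite -scalemxAr !mulmxA PP.
- by rewrite -scalemxAr PS.
Qed.

Theorem theorem4p11 (R : realType) (X : finMetricType R)
    (X_nonempty : (0 < #|X|)%N)
    (Z_unit : similarity_mx X \in unitmx)
    (magnitude_neq0 : magnitude X != 0) :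
  let M : 'M[R]_(1 + #|X|) :=
    block_mx 0 (ones X)^T (ones X) (similarity_mx X) in
  M \in unitmx /\
  invmx M =
    block_mx (- (magnitude X)^-1)%:M ((magnitude X)^-1 *: (weighting X)^T)
      ((magnitude X)^-1 *: weighting X)
      (2^-1 *: moore_penrose (centered_similarity_mx X)).
Proof.
have Zsym := similarity_mx_sym X.
have ones_norm : (#|X|%:R)^-1 * ((ones X)^T *m ones X) 0 0 = 1 :> R.
  rewrite mxE (eq_bigr (fun=> 1)) => [|i _]; last by rewrite !mxE mulr1.
  by rewrite sumr_const card_ord mulVf // pnatr_eq0 -lt0n.
have half_neq0 : 2^-1 != 0 :> R by rewrite invr_eq0 pnatr_eq0.
rewrite /centered_similarity_mx /centering_mx.
rewrite (moore_penrose_compression Zsym Z_unit magnitude_neq0 ones_norm) //.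
rewrite scalerA mulfV // scale1r.
exact: invmx_bordered.
Qed.
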